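(* Let $A$ be a finite alphabet, $(S,\cdot)$ a finite semigroup and $\varphi\colon A^+\to S$ a semigroup morphism. Then for every $x\in S$ there exists a $\varphi$-ramseyan regular expression $E_x$ over the alphabet $A$ whose language is exactly $\varphi^{-1}(x)$.
   Context: $A^+$ is the free semigroup of nonempty finite words over $A$. Regular expressions over $A$ are built from constants (letters / finite sets of letters) using union $+$, concatenation and Kleene star $^*$, with the usual language semantics. A regular expression $E$ is called $\varphi$-ramseyan if for each occurrence $L^*$ of the Kleene star in $E$, the language $L$ of the starred subexpression satisfies $\varphi(L)=\{e\}$ for some idempotent $e=e^2$ of $S$. *)

(* Defs.v *)
From HB Require Import structures.
From mathcomp Require Import all_boot.
From mathcomp Require Import classical_sets.

Set Implicit Arguments.
Unset Strict Implicit.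
Unset Printing Implicit Defensive.

Local Open Scope classical_set_scope.
Local Open Scope group_scope.

#[short(type="finSemigroupType")]
HB.structure Definition FinSemigroup := {S of Semigroup S & Finite S}.

Section FreeSemigroup.

Variable A : finType.

Record freeSemigroup := FreeSemigroup {
  word :> seq A;
  _ : word != [::]
}.

HB.instance Definition _ := [isSub for word].
HB.instance Definition _ := [Choice of freeSemigroup by <:].

Fact freeSemigroup_mul_subproof (u v : freeSemigroup) :
  word u ++ word v != [::].
Proof. by case: u => -[]. Qed.

Definition freeSemigroup_mul (u v : freeSemigroup) :=
  FreeSemigroup (freeSemigroup_mul_subproof u v).

Fact freeSemigroup_mulA : associative freeSemigroup_mul.
Proof. by move=> u v w; apply: val_inj; rewrite /= catA. Qed.

HB.instance Definition _ := isSemigroup.Build freeSemigroup freeSemigroup_mulA.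

End FreeSemigroup.

(* The empty word is not a constant; [Letters finset.set0] denotes the empty   *)
(* language.                                                                  *)
Inductive regexp (A : finType) : Type :=
  | Letters of {set A}
  | Union of regexp A & regexp A
  | Concat of regexp A & regexp A
  | Star of regexp A.

Section Language.

Variable A : finType.

Definition concat_lang (L M : set (seq A)) : set (seq A) :=
  [set u ++ v | u in L & v in M].

Definition star_lang (L : set (seq A)) : set (seq A) :=
  [set flatten ws | ws in [set ws | forall w, w \in ws -> L w]].

Fixpoint language (E : regexp A) : set (seq A) :=
  match E with
  | Letters B => [set [:: a] | a in [set` B]]
  | Union E1 E2 => language E1 `|` language E2
  | Concat E1 E2 => concat_lang (language E1) (language E2)
  | Star E1 => star_lang (language E1)
  end.

End Language.

Section Ramseyan.

Variables (A : finType) (S : semigroupType) (phi : freeSemigroup A -> S).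

(* As phi is undefined at the empty word, phi(L) = Y also requires that L does *)
(* not contain it.                                                            *)
Definition lang_image_eq (L : set (seq A)) (Y : set S) : Prop :=
  ~ L [::] /\ phi @` (@word A @^-1` L) = Y.

Fixpoint ramseyan (E : regexp A) : Prop :=
  match E with
  | Letters _ => True
  | Union E1 E2 => ramseyan E1 /\ ramseyan E2
  | Concat E1 E2 => ramseyan E1 /\ ramseyan E2
  | Star E1 => ramseyan E1 /\
      exists e : S, e * e = e /\ lang_image_eq (language E1) [set e]
  end.

End Ramseyan.

(* Main.v *)
(* By Simon's factorisation forest theorem, some bound [n] is such that every  *)
(* word is built in at most [n] layers from letters, by concatenating two words *)
(* or by concatenating any number of words with the same idempotent value.     *)
(* Bounding the number of layers gives a ramseyan expression, by induction.    *)
(*                                                                            *)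
(* The bound is obtained by induction on the size of the two-sided ideal       *)
(* [M x M] of the value [x], largest first. A word is cut greedily into minimal *)
(* blocks whose ideal is no larger than that of the word; these then all have  *)
(* the same ideal. Colour a cut between two blocks by the pair [(p, q)] of the *)
(* values of what precedes and follows it. Between two cuts of the same colour *)
(* lies a value [u] with [p u = p] and [u q = q], and the equality of the      *)
(* ideals forces [u] to be idempotent and determined by [(p, q)]. Cutting at   *)
(* all occurrences of one colour thus costs a bounded number of layers and     *)
(* removes that colour.                                                       *)
From HB Require Import structures.
Require Import Defs.
From mathcomp Require Import all_boot.
From mathcomp Require Import boolp classical_sets.

Set Implicit Arguments.
Unset Strict Implicit.
Unset Printing Implicit Defensive.

(** [forest] formalises the layers and [forest_bounded] is Simon's theorem. It rests on
    [smooth_forest], for words whose blocks share one ideal, and on [loop_at_unique], by which all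
    factors between cuts of one colour have the same idempotent value. [ramseyan_forest_lang] turns
    layers into expressions; as values are finite in number, finite unions suffice. *)

#[short(type="finMonoidType")]
HB.structure Definition FinMonoid := {M of Monoid M & Finite M}.

(** * Two-sided ideals of a finite monoid *)

Section Ideals.

Variable M : finMonoidType.
Implicit Types a b c p q s t u v : M.
Local Open Scope group_scope.

Definition ideal s : {set M} := finset (fun t => [exists c, t == c.1 * s * c.2]).

Lemma idealP s t : reflect (exists a b, t = a * s * b) (t \in ideal s).
Proof.
rewrite inE; apply: (iffP existsP) => [[[a b] /eqP ->]|[a [b ->]]].
  by exists a, b.
by exists (a, b).
Qed.

Lemma mem_ideal s : s \in ideal s.
Proof. by apply/idealP; exists 1, 1; rewrite mul1g mulg1. Qed.

Lemma ideal_trans s t u : t \in ideal s -> u \in ideal t -> u \in ideal s.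
Proof.
move=> /idealP[a [b ->]] /idealP[c [d ->]]; apply/idealP; exists (c * a), (b * d).
by rewrite !mulgA.
Qed.

Lemma mem_idealMl a s : a * s \in ideal s.
Proof. by apply/idealP; exists a, 1; rewrite mulg1. Qed.

Lemma mem_idealMr a s : s * a \in ideal s.
Proof. by apply/idealP; exists 1, a; rewrite mul1g. Qed.

Lemma ideal_sub s t : t \in ideal s -> ideal t \subset ideal s.
Proof. by move=> st; apply/fintype.subsetP => u; apply: ideal_trans. Qed.

(* Right multiplication by [b] maps [M c u] onto [M u], so that the inclusion *)
(* [M c u <= M u] is an equality.                                             *)
Lemma stable_l c u b : u = c * u * b -> exists m, u = m * (c * u).
Proof.
move=> ucub; set L := [set m * u | m : M]; set L' := [set m * (c * u) | m : M].
suff /setP/(_ u) : L' = L.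
  rewrite [in RHS](_ : u \in L); last by apply/imsetP; exists 1; rewrite ?mul1g.
  by move=> /imsetP[m _ um]; exists m.
apply/eqP; rewrite eqEcard; apply/andP; split.
  by apply/fintype.subsetP => _ /imsetP[m _ ->];
    apply/imsetP; exists (m * c); rewrite ?mulgA.
apply: leq_trans (leq_imset_card (fun x => x * b) L').
apply/subset_leq_card/fintype.subsetP => _ /imsetP[m _ ->]; apply/imsetP.
exists (m * (c * u)); first by apply/imsetP; exists m.
by rewrite -mulgA -ucub.
Qed.

(** Dually, left multiplication by [c] maps [u b M] onto [u M]. *)
Lemma stable_r c u b : u = c * u * b -> exists m, u = u * b * m.
Proof.
move=> ucub; set L := [set u * m | m : M]; set L' := [set u * b * m | m : M].
suff /setP/(_ u) : L' = L.
  rewrite [in RHS](_ : u \in L); last by apply/imsetP; exists 1; rewrite ?mulg1.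
  by move=> /imsetP[m _ um]; exists m.
apply/eqP; rewrite eqEcard; apply/andP; split.
  by apply/fintype.subsetP => _ /imsetP[m _ ->];
    apply/imsetP; exists (b * m); rewrite ?mulgA.
apply: leq_trans (leq_imset_card (fun x => c * x) L').
apply/subset_leq_card/fintype.subsetP => _ /imsetP[m _ ->]; apply/imsetP.
exists (u * b * m); first by apply/imsetP; exists m.
by rewrite !mulgA -ucub.
Qed.

(** Models the value of a factor between two cuts of colour [(p, q)]. The equations put [p] and [q]
    in the ideal of [u], so the three ideals coincide. *)
Definition loop_at p q u :=
  [/\ p * u = p, u * q = q, u \in ideal p & u \in ideal q].

(** Since [u = a p b = a p u b], [stable_l] makes [u] a left multiple of [p], and [p v = p] gives
    [u v = u]. Dually [v] is a right multiple of [q]. Taking [v = u] yields idempotence. *)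
Lemma loop_at_unique p q u v :
  loop_at p q u -> loop_at p q v -> [/\ u * v = u & u * v = v].
Proof.
move=> [pu uq /idealP[a [b uE]] _] [pv vq _ /idealP[c [d vE]]]; split.
  have [|m um] := @stable_l (a * p) u b; first by rewrite -(mulgA a) pu.
  have {}um : u = m * a * p by rewrite [LHS]um -(mulgA a) pu mulgA.
  by rewrite um -mulgA pv.
have [|m vm] := @stable_r c v (q * d); first by rewrite -(mulgA c) !mulgA -(mulgA c) vq.
have {}vm : v = q * (d * m) by rewrite [LHS]vm !mulgA vq.
by rewrite vm mulgA uq.
Qed.

End Ideals.

(** * Factorisation forests of bounded height *)

Section Forests.

Variables (A : eqType) (M : finMonoidType) (f : A -> M).
Implicit Types (u v w : seq A) (us vs ws : seq (seq A)).
Local Open Scope group_scope.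

Definition value w : M := \prod_(a <- w) f a.

Lemma value_cat u v : value (u ++ v) = value u * value v.
Proof. exact: big_cat. Qed.

Lemma value_flatten_mem us u :
  u \in us -> value (flatten us) \in ideal (value u).
Proof.
case/splitPr=> vs ws; apply/idealP.
exists (value (flatten vs)), (value (flatten ws)).
by rewrite flatten_cat /= !value_cat mulgA.
Qed.

Lemma value_flatten_idem e us : e * e = e -> us != [::] ->
  (forall u, u \in us -> value u = e) -> value (flatten us) = e.
Proof.
move=> ee; case: us => // u us _.
elim: us u => [|v us IHus] u usE; first by rewrite /= cats0 usE ?mem_head.
rewrite -[flatten _]/(u ++ flatten (v :: us)) value_cat IHus.
  by rewrite usE ?mem_head.
by move=> w wus; rewrite usE // inE wus orbT.
Qed.

Fixpoint forest n w : Prop :=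
  match n with
  | 0 => exists a, w = [:: a]
  | n.+1 => [\/ forest n w,
      exists u v, [/\ w = u ++ v, forest n u & forest n v] |
      exists e us, [/\ w = flatten us, us != [::], e * e = e &
        forall u, u \in us -> forest n u /\ value u = e]]
  end.

Lemma forest_letter n a : forest n [:: a].
Proof. by elim: n => [|n IH]; [exists a | apply: Or31]. Qed.

Lemma forest_leq m n w : m <= n -> forest m w -> forest n w.
Proof.
move=> /subnK <-; elim: (n - m) => [//|k IH] /IH; rewrite addSn; exact: Or31.
Qed.

Lemma forest_cat n u v : forest n u -> forest n v -> forest n.+1 (u ++ v).
Proof. by move=> Fu Fv; apply: Or32; exists u, v. Qed.

Lemma forest_flatten_loops n p q us v :
    (forall u, u \in us -> forest n u /\ loop_at p q (value u)) ->
  forest n v -> forest n.+2 (flatten us ++ v).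
Proof.
case: us => [|u us] loops Fv; first by do 2!apply: Or31.
have [_ lu] := loops u (mem_head _ _).
apply: forest_cat; last by apply: Or31.
apply: Or33; exists (value u), (u :: us); split=> //.
  by have [] := loop_at_unique lu lu.
move=> w /loops[Fw lw]; split=> //.
by have [-> ->] := loop_at_unique lu lw.
Qed.

(** [l] and [r] are the values of the context, so that a factor keeps the cut colours of the whole
    word. *)
Definition cuts_in (C : {set M * M}) l r ws := forall us vs,
  ws = us ++ vs -> us != [::] -> vs != [::] ->
  (l * value (flatten us), value (flatten vs) * r) \in C.

Lemma cuts_in_catr C l r us vs :
  cuts_in C l r (us ++ vs) -> cuts_in C (l * value (flatten us)) r vs.
Proof.
move=> cuv vs1 vs2 vsE vs1N vs2N.
rewrite -mulgA -value_cat -flatten_cat; apply: cuv => //; first by rewrite vsE catA.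
by case: (us).
Qed.

Section Smooth.

Variables (n : nat) (t : M).

(** Together with [l * value (flatten ws) * r = t], this forces every block to have the ideal of
    [t]. *)
Definition blocks ws :=
  forall w, w \in ws -> forest n w /\ value w \in ideal t.

Lemma blocks_sub us vs : {subset us <= vs} -> blocks vs -> blocks us.
Proof. by move=> sub bvs w /sub/bvs. Qed.

Lemma blocks_ideal us vs : us != [::] -> blocks (us ++ vs) ->
  value (flatten us) \in ideal t.
Proof.
case: us => //= u us _ /(_ u (mem_head _ _))[_ ut].
rewrite value_cat; exact: ideal_trans ut (mem_idealMr _ _).
Qed.

(* [ws] accumulates the blocks read since the last cut of colour [(p, q)].    *)
Lemma smooth_loops m p q C r :
    p * q = t ->
    (forall l r ws, ws != [::] -> blocks ws -> l * value (flatten ws) * r = t ->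
      cuts_in (C :\ (p, q)) l r ws -> forest m (flatten ws)) ->
  forall vs ws, ws != [::] -> blocks (ws ++ vs) ->
    value (flatten (ws ++ vs)) * r = q ->
    cuts_in (C :\ (p, q)) p (value (flatten vs) * r) ws ->
    cuts_in C p r (ws ++ vs) ->
  exists us v, [/\ flatten (ws ++ vs) = flatten us ++ v,
    forall u, u \in us -> forest m u /\ loop_at p q (value u) & forest m v].
Proof.
move=> pq IH; elim=> [|v vs IHvs] ws wsN bws qE cws cwvs.
  exists [::], (flatten (ws ++ [::])); split=> //.
  apply: (IH p r) => //; first by rewrite cats0.
    by rewrite -mulgA qE.
  by move: cws; rewrite cats0 /value big_nil mul1g.
have [[pws vsq]|/eqP cN] :=
    (p * value (flatten ws), value (flatten (v :: vs)) * r) =P (p, q).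
  have [||||us [w [usE lus Fw]]] := IHvs [:: v] isT; rewrite ?cat1s //.
  - by apply: blocks_sub bws => w; rewrite mem_cat => ->; rewrite orbT.
  - by case=> [//|? [|//]] vs' [_ <-].
  - by have := cuts_in_catr cwvs; rewrite pws.
  have wst := blocks_ideal wsN bws.
  exists (flatten ws :: us), w; split=> //.
    by rewrite flatten_cat /= -catA -usE.
  move=> u; rewrite inE => /orP[/eqP ->|]; last exact: lus.
  split.
    apply: (IH p q) => //.
    - by apply: blocks_sub bws => x xws; rewrite mem_cat xws.
    - by rewrite pws.
    - by move: cws; rewrite /= vsq.
  split=> //.
  - by rewrite -[in LHS]vsq mulgA -value_cat -qE flatten_cat.
  - by apply: ideal_trans wst; rewrite -pq mem_idealMr.
  - by apply: ideal_trans wst; rewrite -pq mem_idealMl.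
(* Otherwise [v] joins [ws]; the only new inner cut is the one just before [v], whose colour is not
   [(p, q)]. *)
rewrite -cat_rcons; apply: IHvs; rewrite ?cat_rcons //; first by case: (ws).
move=> us1; case/lastP=> [//|us2 x].
rewrite -rcons_cat => /rcons_inj[wsE <-] us1N _.
case: us2 wsE => [|y us2] wsE.
  rewrite cats0 in wsE; rewrite -wsE in_setD1 /= cats0.
  rewrite mulgA -value_cat cN; exact: (cwvs ws (v :: vs)).
have := cws us1 (y :: us2) wsE us1N isT.
by rewrite flatten_rcons value_cat mulgA -mulgA /= !value_cat !mulgA.
Qed.

(** Induction on the number of colours: the first block is set apart and the rest is split at all
    cuts with the colour of the first cut. The three layers serve the idempotent product, the last
    piece and the first block. *)
Lemma smooth_forest (C : {set M * M}) l r ws :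
    ws != [::] -> blocks ws -> l * value (flatten ws) * r = t ->
  cuts_in C l r ws -> forest (n + 3 * #|C|) (flatten ws).
Proof.
have [k] := ubnP #|C|.
elim: k C l r ws => // k IH C l r [//|w [|v ws]] Ck _ bws tE cws.
  rewrite /= cats0; apply: forest_leq (leq_addr _ _) _.
  by have [] := bws w (mem_head _ _).
set p := l * value w; set q := value (flatten (v :: ws)) * r.
have pqC : (p, q) \in C.
  by have := cws [:: w] (v :: ws) erefl isT isT; rewrite /= cats0.
have CE := cardsD1 (p, q) C; rewrite pqC add1n in CE.
have [||||||us [x [xE lus Fx]]] :=
    @smooth_loops (n + 3 * #|C :\ (p, q)|) p q C r _ _ ws [:: v] isT.
- by rewrite -tE /p /q /= [in RHS]value_cat !mulgA.
- by move=> l' r' ws' *; apply: (IH _ l' r') => //; rewrite CE in Ck.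
- by apply: blocks_sub bws => y; rewrite [in X in _ -> X]inE => ->; rewrite orbT.
- by [].
- by case=> [//|? [|//]] vs' [_ <-].
- by have := @cuts_in_catr _ _ _ [:: w] _ cws; rewrite /= cats0.
rewrite CE mulnS [3 + _]addnC addnA addn3.
rewrite (_ : flatten _ = w ++ flatten (v :: ws)) // -cat1s xE.
apply: forest_cat; last exact: forest_flatten_loops lus Fx.
apply: forest_leq (bws w (mem_head _ _)).1.
by rewrite -addnS -addnS leq_addr.
Qed.

End Smooth.

(** A block ends at the letter that shrinks its ideal to size at most [r]; what precedes that letter
    is empty or covered by the hypothesis. *)
Lemma greedy_blocks n r w :
    (forall u, u != [::] -> r < #|ideal (value u)| -> forest n u) ->
  exists ws v, [/\ w = flatten ws ++ v,
    forall u, u \in ws -> forest n.+1 u /\ #|ideal (value u)| <= r &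
    v = [::] \/ forest n v /\ r < #|ideal (value v)|].
Proof.
move=> Fn; elim/last_ind: w => [|w a [ws [v [wE bws vP]]]].
  by exists [::], [::]; split=> //; left.
have [rva|var] := ltnP r #|ideal (value (rcons v a))|.
  exists ws, (rcons v a); split=> //; first by rewrite wE rcons_cat.
  by right; split=> //; apply: Fn => //; case: (v).
exists (rcons ws (rcons v a)), [::]; split; last by left.
  by rewrite flatten_rcons cats0 wE rcons_cat.
move=> u; rewrite mem_rcons inE => /orP[/eqP ->|]; last exact: bws.
split=> //; case: vP => [->|[Fv _]]; first exact: forest_letter.
by rewrite -cats1; apply: forest_cat Fv (forest_letter _ _).
Qed.

Theorem forest_bounded : exists n, forall w, w != [::] -> forest n w.
Proof.
suff bounded k : k <= #|M| ->
    exists n, forall w, w != [::] -> #|M| - k < #|ideal (value w)| -> forest n w.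
  have [//|n Fn] := bounded #|M|; exists n => w wN; apply: Fn => //.
  rewrite subnn; apply/card_gt0P.
  by exists (value w); exact: mem_ideal.
elim: k => [_|k IH kM].
  by exists 0 => w _; rewrite subn0 ltnNge max_card.
have [n Fn] := IH (ltnW kM); set r := #|M| - k in Fn.
have rE : r = (#|M| - k.+1).+1 by rewrite -[RHS]subSn //.
(* [n.+1] layers for a block, three for each possible colour, one to append the remainder [v]. *)
exists (n.+1 + 3 * #|[set: M * M]|).+1 => w wN; rewrite -rE => rw.
have [ws [v [wE bws vP]]] := greedy_blocks w Fn.
have [ws0|wsN] := eqVneq ws [::].
  move: wN; rewrite wE ws0 -[flatten [::] ++ v]/v; case: vP => [->//|[Fv _] _].
  by apply: forest_leq Fv; rewrite -addnS addSnnS leq_addr.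
set t := value (flatten ws).
have rt : r <= #|ideal t|.
  apply: leq_trans rw _; apply/subset_leq_card/ideal_sub.
  by rewrite wE value_cat mem_idealMr.
have Fws : forest (n.+1 + 3 * #|[set: M * M]|) (flatten ws).
  apply: (@smooth_forest n.+1 t _ 1 1) => //; last 2 first.
  - by rewrite mul1g mulg1.
  - by move=> us vs *; rewrite finset.in_setT.
  move=> u uws; have [Fu ru] := bws u uws; split=> //.
  (* The ideal of a block contains that of [t] and is no larger, by the choice of [r]. *)
  suff /eqP -> : ideal t == ideal (value u) by exact: mem_ideal.
  rewrite eqEcard (leq_trans ru rt) andbT; apply: ideal_sub.
  exact: value_flatten_mem.
rewrite wE; case: vP => [->|[Fv _]].
  by rewrite cats0; apply: forest_leq Fws.
apply: forest_cat Fws (forest_leq _ Fv).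
by rewrite addSnnS leq_addr.
Qed.

End Forests.

(** * Adjoining an identity to the semigroup *)

Section AdjoinOne.

Variable S : finSemigroupType.
Local Open Scope group_scope.

(** The identity is fresh even if [S] has one; it is the value of the empty word. *)
Definition adjoin_one := option S.

HB.instance Definition _ := Finite.on adjoin_one.

Definition adjoin_one_mul (x y : adjoin_one) : adjoin_one :=
  match x, y with
  | Some s, Some t => Some (s * t)
  | None, _ => y
  | _, None => x
  end.

Fact adjoin_one_mulA : associative adjoin_one_mul.
Proof. by move=> [x|] [y|] [z|] //=; rewrite mulgA. Qed.

Fact adjoin_one_mul1 : left_id None adjoin_one_mul.
Proof. by case. Qed.

Fact adjoin_one_mulr1 : right_id None adjoin_one_mul.
Proof. by case. Qed.

HB.instance Definition _ :=
  isMonoid.Build adjoin_one adjoin_one_mulA adjoin_one_mul1 adjoin_one_mulr1.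

End AdjoinOne.

(** * From forests to ramseyan expressions *)

Section RamseyanLanguages.

Variables (A : finType) (S : finSemigroupType).
Variable phi : {multiplicative freeSemigroup A -> S}.
Implicit Types (w : seq A) (L K : set (seq A)).
Local Open Scope group_scope.
Local Open Scope classical_set_scope.

Definition ramseyan_lang L := exists E, ramseyan phi E /\ language E = L.

Lemma ramseyan_lang_letters (P : pred A) :
  ramseyan_lang [set w | exists2 a, P a & w = [:: a]].
Proof.
exists (Letters (finset P)); split=> //; apply/seteqP; split=> w /=.
  by move=> [a]; rewrite /= inE => Pa <-; exists a.
by move=> [a Pa ->]; exists a; rewrite //= inE.
Qed.

Lemma ramseyan_lang0 : ramseyan_lang set0.
Proof.
have := ramseyan_lang_letters pred0; congr ramseyan_lang.
by apply/seteqP; split=> w // [].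
Qed.

Lemma ramseyan_langU L K :
  ramseyan_lang L -> ramseyan_lang K -> ramseyan_lang (L `|` K).
Proof. by move=> [E [rE <-]] [F [rF <-]]; exists (Union E F). Qed.

Lemma ramseyan_lang_concat L K :
  ramseyan_lang L -> ramseyan_lang K -> ramseyan_lang (concat_lang L K).
Proof. by move=> [E [rE <-]] [F [rF <-]]; exists (Concat E F). Qed.

Lemma ramseyan_lang_exists (I : finType) (L : I -> set (seq A)) :
  (forall i, ramseyan_lang (L i)) -> ramseyan_lang [set w | exists i, L i w].
Proof.
move=> rL; suff : ramseyan_lang [set w | exists2 i, i \in enum I & L i w].
  congr ramseyan_lang; apply/seteqP; split=> w /= [i]; first by exists i.
  by exists i; rewrite ?mem_enum.
elim: (enum I) => [|i s IHs].
  have := ramseyan_lang0; congr ramseyan_lang.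
  by apply/seteqP; split=> w // [].
have := ramseyan_langU (rL i) IHs; congr ramseyan_lang.
apply/seteqP; split=> w /=.
  move=> [Lw|[j js Lw]]; first by exists i; rewrite ?mem_head.
  by exists j; rewrite // inE js orbT.
by move=> [j]; rewrite inE => /orP[/eqP ->|js] Lw; [left|right; exists j].
Qed.

Lemma ramseyan_lang_star L (e : S) :
    ramseyan_lang L -> L !=set0 -> ~ L [::] -> e * e = e ->
    (forall u : freeSemigroup A, L (word u) -> phi u = e) ->
  ramseyan_lang (star_lang L).
Proof.
move=> [E [rE <-]] [w Ew] EN ee phiE; exists (Star E); split=> //=.
split=> //; exists e; split=> //; split=> //.
apply/seteqP; split=> x /=; first by move=> [u Eu <-]; exact: phiE.
have wN : w != [::] by apply: contra_notN EN => /eqP <-.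
by move=> ->; exists (FreeSemigroup wN); rewrite //; exact: phiE.
Qed.

Definition letter_value (a : A) : adjoin_one S :=
  Some (phi (@FreeSemigroup A [:: a] isT)).

Lemma value_word (u : freeSemigroup A) :
  value letter_value (word u) = Some (phi u).
Proof.
case: u => w wN /=; elim: w wN => // a [|b w] IH wN.
  by rewrite /value big_seq1; congr (Some (phi _)); apply: val_inj.
rewrite /value big_cons [X in _ * X](IH isT).
rewrite -[LHS]/(Some (_ * _)) -gmulfM.
by congr (Some (phi _)); apply: val_inj.
Qed.

Lemma forest_neq0 n w : forest letter_value n w -> w != [::].
Proof.
elim: n w => [|n IH] w /=; first by move=> [a ->].
case=> [/IH //|[u [v [-> /IH uN _]]]|[e [us [-> usN _ usF]]]]; first by case: u uN.
by case: us usN usF => // u us _ /(_ u (mem_head _ _))[/IH + _] /=; case: u.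
Qed.

Definition forest_lang n x :=
  [set w | forest letter_value n w /\ value letter_value w = x].

(** The language is [L L^*] if [x] is idempotent and [L] is nonempty, and empty otherwise. An empty
    [L] cannot be starred, as its image is not a singleton. *)
Lemma ramseyan_lang_loops L x :
    ramseyan_lang L ->
    (forall w, L w -> w != [::] /\ value letter_value w = x) ->
  ramseyan_lang [set w | x * x = x /\ exists us, [/\ w = flatten us,
    us != [::] & forall u, u \in us -> L u]].
Proof.
move=> rL Lx; have [[xx [w Lw]]|noL] := EM (x * x = x /\ L !=set0); last first.
  have := ramseyan_lang0; congr ramseyan_lang.
  apply/seteqP; split=> // w [xx [us [_ usN usL]]]; case: noL; split=> //.
  by case: us usN usL => // u us _ usL; exists u; apply: usL; rewrite mem_head.
have [wN wx] := Lx w Lw; set e := phi (FreeSemigroup wN).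
have xE : x = Some e by rewrite -wx -value_word.
have ee : e * e = e by move: xx; rewrite xE => -[].
have rLs : ramseyan_lang (star_lang L).
  apply: (ramseyan_lang_star rL _ _ ee); first by exists w.
    by move=> /Lx[].
  by move=> u /Lx[_]; rewrite value_word xE => -[].
have := ramseyan_lang_concat rL rLs.
congr ramseyan_lang; apply/seteqP; split=> v /=.
  move=> [u Lu [_ [us usL <-] <-]]; split=> //; exists (u :: us); split=> //.
  by move=> u'; rewrite inE => /orP[/eqP ->|/usL].
move=> [_ [us [-> usN usL]]]; case: us usN usL => // u us _ usL.
exists u; first by apply: usL; rewrite mem_head.
by exists (flatten us) => //; exists us => // u' us'; apply: usL; rewrite inE us' orbT.
Qed.

Lemma ramseyan_forest_lang n x : ramseyan_lang (forest_lang n x).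
Proof.
elim: n x => [|n IH] x.
  have := ramseyan_lang_letters (fun a => letter_value a == x).
  congr ramseyan_lang; apply/seteqP; split=> w /=.
    by move=> [a /eqP <- ->]; split; [exists a | rewrite /value big_seq1].
  by move=> [[a ->]]; rewrite /value big_seq1 => fa; exists a; rewrite ?fa.
have rcat : ramseyan_lang [set w | exists yz : adjoin_one S * adjoin_one S,
    yz.1 * yz.2 = x /\ concat_lang (forest_lang n yz.1) (forest_lang n yz.2) w].
  apply: ramseyan_lang_exists => yz; have [yzx|yzN] := EM (yz.1 * yz.2 = x).
    have := ramseyan_lang_concat (IH yz.1) (IH yz.2); congr ramseyan_lang.
    by apply/seteqP; split=> w //= [].
  have := ramseyan_lang0; congr ramseyan_lang.
  by apply/seteqP; split=> w //= [].
have rloops := ramseyan_lang_loops (IH x) (fun w Fw => conj (forest_neq0 Fw.1) Fw.2).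
have := ramseyan_langU (IH x) (ramseyan_langU rcat rloops).
congr ramseyan_lang; apply/seteqP; split=> w /=.
  case=> [[Fw wx]|[[[y z] /= [yzx [u [Fu uy] [v [Fv vz] <-]]]]|]].
  - by split=> //; apply: Or31.
  - by split; [apply: Or32; exists u, v | rewrite value_cat uy vz].
  move=> [xx [us [-> usN usF]]]; split; first by apply: Or33; exists x, us.
  exact: value_flatten_idem xx usN (fun u us => (usF u us).2).
move=> [Fw wx]; case: Fw.
- by left.
- move=> [u [v [wE Fu Fv]]]; right; left.
  exists (value letter_value u, value letter_value v); split=> /=.
    by rewrite -value_cat -wE.
  by exists u => //; exists v.
move=> [e [us [wE usN ee usF]]]; right; right.
(* The idempotent shared by the factors is the value of the word itself, so [IH x] suffices. *)
have xe : x = e.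
  by rewrite -wx wE; apply: value_flatten_idem ee usN (fun u us => (usF u us).2).
by rewrite xe; split=> //; exists us.
Qed.

End RamseyanLanguages.

Local Open Scope classical_set_scope.

Theorem theorem2 (A : finType) (S : finSemigroupType)
    (phi : {multiplicative freeSemigroup A -> S}) :
  forall x : S, exists E : regexp A,
    ramseyan phi E /\ language E = @word A @` (phi @^-1` [set x]).
Proof.
move=> x; have [n Fn] := forest_bounded (@letter_value A S phi).
(* For this [n] every nonempty word is a forest, so only the condition on the value remains. *)
have := ramseyan_forest_lang phi n (Some x); congr ramseyan_lang.
apply/seteqP; split=> w /=.
  move=> [Fw]; have wN := forest_neq0 Fw.
  rewrite -[w in value _ w]/(word (FreeSemigroup wN)) value_word => -[wx].
  by exists (FreeSemigroup wN).
by move=> [u ux <-]; split; [apply: Fn; case: (u) | rewrite value_word ux].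
Qed.
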